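(* Let $k\geq 1$ be an integer and let $\Gamma$ be the group with generators $e_1,e_2,e_3,e_4,\alpha$ and defining relations $$[e_2,e_1]=[e_3,e_1]=[e_4,e_1]=[e_3,e_2]=[e_4,e_2]=1,\qquad [e_4,e_3]=e_1^{2k},$$ $$\alpha e_1=e_1\alpha,\quad \alpha e_2=e_2\alpha,\quad \alpha e_3=e_3^{-1}\alpha,\quad \alpha e_4=e_4^{-1}\alpha,\quad \alpha^2=e_1.$$ Then $\mathrm{Spec}_R(\Gamma)=4\mathbb{N}\cup\{\infty\}$.
   Context: For a group $\Gamma$ and $\varphi\in\mathrm{Aut}(\Gamma)$, define $g\sim_\varphi g'$ iff there is $h\in\Gamma$ with $g=hg'\varphi(h)^{-1}$. The Reidemeister number $R(\varphi)\in\{1,2,3,\dots\}\cup\{\infty\}$ is the number of equivalence classes of $\sim_\varphi$, and $\mathrm{Spec}_R(\Gamma)=\{R(\varphi)\mid\varphi\in\mathrm{Aut}(\Gamma)\}$. Here $\mathbb{N}=\{1,2,3,\dots\}$ and $4\mathbb{N}=\{4n\mid n\in\mathbb{N}\}$. Commutators are $[a,b]=aba^{-1}b^{-1}$. *)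

(* Defs.v *)
From HB Require Import structures.
From mathcomp Require Import all_boot finmap.
From mathcomp Require Import boolp classical_sets cardinality constructive_ereal.

Set Implicit Arguments.
Unset Strict Implicit.
Unset Printing Implicit Defensive.

Local Open Scope group_scope.

(* mathcomp's [~ a, b] is a^-1 b^-1 a b; the convention used here is
   a b a^-1 b^-1. *)
Definition commutator (G : baseGroupType) (a b : G) : G :=
  a * b * a^-1 * b^-1.

(* The free monoid with involution on X: (x, false) stands for x and (x, true)
   for x^-1. Words are not reduced, so w * w^-1 = 1 fails here; it holds in the
   quotient [presented] below. *)
Definition word (X : choiceType) : Type := seq (X * bool).

HB.instance Definition _ (X : choiceType) :=
  Choice.copy (word X) (seq (X * bool)%type).

Section Words.
Variable X : choiceType.
Implicit Types u v w : word X.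

Definition word_inv w : word X := rev [seq (l.1, ~~ l.2) | l <- w].

Definition letter (x : X) : word X := [:: (x, false)].

Fact word_mulA : associative (fun u v : word X => u ++ v : word X).
Proof. exact: catA. Qed.

Fact word_mul1 : left_id ([::] : word X) (fun u v : word X => u ++ v : word X).
Proof. by []. Qed.

Fact word_invK : involutive word_inv.
Proof.
move=> w; rewrite /word_inv map_rev revK -map_comp -[RHS]map_id.
by apply: eq_map => -[x b] /=; rewrite negbK.
Qed.

Fact word_invM :
  {morph word_inv : u v / (u ++ v : word X) >-> (v ++ u : word X)}.
Proof. by move=> u v; rewrite /word_inv map_cat rev_cat. Qed.

HB.instance Definition _ := isStarMonoid.Build (word X)
  word_mulA word_mul1 word_invK word_invM.

End Words.

(* The congruence on words generated by the relations u = v for (u, v) \in rels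
   and by free cancellation, so that the quotient is the group < X | rels >. *)
Inductive pres_eq (X : choiceType) (rels : seq (word X * word X)) :
    word X -> word X -> Prop :=
| PresRel u v : (u, v) \in rels -> pres_eq rels u v
| PresCancel x : pres_eq rels (letter x * (letter x)^-1) 1
| PresCancelV x : pres_eq rels ((letter x)^-1 * letter x) 1
| PresMul u u' v v' :
    pres_eq rels u u' -> pres_eq rels v v' -> pres_eq rels (u * v) (u' * v')
| PresRefl u : pres_eq rels u u
| PresSym u v : pres_eq rels u v -> pres_eq rels v u
| PresTrans v u w : pres_eq rels u v -> pres_eq rels v w -> pres_eq rels u w.

Section Presentation.
Variables (X : choiceType) (rels : seq (word X * word X)).

Definition pres_rel (u v : word X) : bool := `[< pres_eq rels u v >].

Fact pres_rel_refl : reflexive pres_rel.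
Proof. by move=> u; apply/asboolP; exact: PresRefl. Qed.

Fact pres_rel_sym : symmetric pres_rel.
Proof. by move=> u v; apply/asboolP/asboolP; exact: PresSym. Qed.

Fact pres_rel_trans : transitive pres_rel.
Proof.
by move=> v u w /asboolP uv /asboolP vw; apply/asboolP; exact: PresTrans uv vw.
Qed.

Canonical pres_equiv := EquivRel pres_rel
  pres_rel_refl pres_rel_sym pres_rel_trans.

Definition presented := {eq_quot pres_equiv}%qT.

HB.instance Definition _ := Choice.on presented.
HB.instance Definition _ := EqQuotient.on presented.

Local Open Scope quotient_scope.

Definition pres_class (w : word X) : presented := \pi_presented w.

Lemma pres_classP u v : pres_class u = pres_class v <-> pres_eq rels u v.
Proof.
split=> [/eqmodP /asboolP // | uv].
by apply/eqmodP; apply/asboolP.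
Qed.

Lemma pres_class_repr (a : presented) : pres_class (repr a) = a.
Proof. exact: reprK. Qed.

Lemma pres_repr_class w : pres_eq rels (repr (pres_class w)) w.
Proof. by apply/pres_classP; rewrite pres_class_repr. Qed.

Lemma pres_eq_mulV w : pres_eq rels (w * w^-1) 1.
Proof.
elim: w => [|[x b] s IHs]; first exact: PresRefl.
pose w : word X := s; pose l : word X := [:: (x, b)].
have -> : ((x, b) :: s : word X) = l * w by [].
have -> : l * w * (l * w)^-1 = l * (w * w^-1) * l^-1 by rewrite invgM !mulgA.
apply: (@PresTrans _ _ (l * 1 * l^-1)).
  apply: PresMul; last exact: PresRefl.
  by apply: PresMul; [exact: PresRefl | exact: IHs].
by rewrite mulg1 /l; case: (b); [exact: PresCancelV | exact: PresCancel].
Qed.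

Lemma pres_eq_mulVw w : pres_eq rels (w^-1 * w) 1.
Proof. by have := pres_eq_mulV w^-1; rewrite invgK. Qed.

Lemma pres_eq_inv u v : pres_eq rels u v -> pres_eq rels u^-1 v^-1.
Proof.
move=> uv; apply: (@PresTrans _ _ (u^-1 * (v * v^-1))).
  rewrite -[X in pres_eq _ X]mulg1; apply: PresMul; first exact: PresRefl.
  exact: PresSym (pres_eq_mulV v).
rewrite mulgA -[X in pres_eq _ _ X]mul1g; apply: PresMul; last exact: PresRefl.
apply: PresTrans (pres_eq_mulVw u).
by apply: PresMul; [exact: PresRefl | exact: PresSym].
Qed.

Definition pres_mul (a b : presented) : presented :=
  pres_class (repr a * repr b).
Definition pres_inv (a : presented) : presented := pres_class (repr a)^-1.

Fact pres_mulE u v :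
  pres_mul (pres_class u) (pres_class v) = pres_class (u * v).
Proof. by apply/pres_classP; apply: PresMul; exact: pres_repr_class. Qed.

Fact pres_invE u : pres_inv (pres_class u) = pres_class u^-1.
Proof. by apply/pres_classP; apply: pres_eq_inv; exact: pres_repr_class. Qed.

Fact pres_mulA : associative pres_mul.
Proof.
move=> a b c; rewrite -(pres_class_repr a) -(pres_class_repr b).
by rewrite -(pres_class_repr c) !pres_mulE mulgA.
Qed.

Fact pres_mul1 : left_id (pres_class 1) pres_mul.
Proof. by move=> a; rewrite -(pres_class_repr a) pres_mulE mul1g. Qed.

Fact pres_mulr1 : right_id (pres_class 1) pres_mul.
Proof. by move=> a; rewrite -(pres_class_repr a) pres_mulE mulg1. Qed.

Fact pres_mulV : left_inverse (pres_class 1) pres_inv pres_mul.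
Proof.
move=> a; rewrite -(pres_class_repr a) pres_invE pres_mulE.
by apply/pres_classP; exact: pres_eq_mulVw.
Qed.

Fact pres_mulVr : right_inverse (pres_class 1) pres_inv pres_mul.
Proof.
move=> a; rewrite -(pres_class_repr a) pres_invE pres_mulE.
by apply/pres_classP; exact: pres_eq_mulV.
Qed.

HB.instance Definition _ := isGroup.Build presented
  pres_mulA pres_mul1 pres_mulr1 pres_mulV pres_mulVr.

Lemma pres_classM u v : pres_class (u * v) = pres_class u * pres_class v.
Proof. by rewrite -pres_mulE. Qed.

Lemma pres_classV u : pres_class u^-1 = (pres_class u)^-1.
Proof. by rewrite -pres_invE. Qed.

Lemma pres_class1 : pres_class 1 = 1.
Proof. by []. Qed.

End Presentation.

Section Reidemeister.
Variable G : groupType.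
Local Open Scope classical_set_scope.

Definition twisted_conj (phi : G -> G) (g g' : G) : Prop :=
  exists h : G, g = h * g' * (phi h)^-1.

Definition twisted_class (phi : G -> G) (g : G) : set G :=
  [set g' | twisted_conj phi g g'].

(* The values {1, 2, ...} and infinity are encoded as n%:E and +oo in \bar nat. *)
Definition reidemeister_number (phi : G -> G) : \bar nat :=
  if `[< finite_set (range (twisted_class phi)) >]
  then (#|` fset_set (range (twisted_class phi))|)%:E
  else +oo%E.

(* Multiplicativity alone makes phi preserve 1 and inverses, so the bijective
   phi : {multiplicative G -> G} are exactly the automorphisms of G. *)
Definition Spec_R : set (\bar nat) :=
  [set reidemeister_number phi
    | phi in [set phi : {multiplicative G -> G} | bijective phi]].

End Reidemeister.

Definition e1 : word 'I_5 := letter (@Ordinal 5 0 isT).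
Definition e2 : word 'I_5 := letter (@Ordinal 5 1 isT).
Definition e3 : word 'I_5 := letter (@Ordinal 5 2 isT).
Definition e4 : word 'I_5 := letter (@Ordinal 5 3 isT).
Definition alpha : word 'I_5 := letter (@Ordinal 5 4 isT).

Definition Gamma_rels (k : nat) : seq (word 'I_5 * word 'I_5) :=
  [:: (commutator e2 e1, 1);
      (commutator e3 e1, 1);
      (commutator e4 e1, 1);
      (commutator e3 e2, 1);
      (commutator e4 e2, 1);
      (commutator e4 e3, e1 ^+ (2 * k)%N);
      (alpha * e1, e1 * alpha);
      (alpha * e2, e2 * alpha);
      (alpha * e3, e3^-1 * alpha);
      (alpha * e4, e4^-1 * alpha);
      (alpha ^+ 2, e1)].

Definition Gamma (k : nat) : groupType := presented (Gamma_rels k).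

(* Main.v *)
From HB Require Import structures.
Require Import Defs.
From mathcomp Require Import all_boot all_algebra finmap zify ring.
From mathcomp Require Import boolp classical_sets cardinality constructive_ereal.

(** Every element of the group is uniquely alpha^a e2^b e3^c e4^d, so the
    group is a concrete law on Z^4 ([model], [Gamma_isog]). In it e1 = alpha^2
    and e2 generate the center, e3 and e4 commute up to e1^(2k), and alpha
    inverts e3 and e4. The elements with a even form a subgroup N of index two.

    An automorphism phi ([auto_shapeP]) preserves the center and N. It acts on
    N / center = Z^2 by an integer matrix M, the relation [e4, e3] = e1^(2k)
    forces phi(e1) = e1^D with D = det M = 1 or -1, and phi(e2) = e1^t e2^eps
    with eps = 1 or -1. Three situations make the Reidemeister number infinite.
    - eps = 1: the exponent of e2 is invariant under twisted conjugacy
      ([reidemeister_eps1]).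
    - eps = -1 and D = 1: one of 1 - M and -1 - M is injective. For g = 1 or
      g = alpha accordingly, the elements g e1^n are pairwise not twisted
      conjugate, because phi fixes e1 ([reidemeister_det1]).
    - D = -1 and tr M = 0: M has eigenvalue 1, and a covector fixed by M
      separates infinitely many classes ([reidemeister_trace0]).

    There remains D = eps = -1 and T = tr M nonzero, where the number is 4|T|
    ([reidemeister_finite]). The classes for twisting by elements of N alone are
    counted first. Modulo the center, w in Z^2 acts on N as the translation by
    (1 - M) w, and on the other coset of N as the translation by (-1 - M) w. Both
    matrices have determinant T or -T, so their lattices have index |T|. Each
    coset of a lattice carries 4 classes, because the elements z phi(z)^-1 with z
    central form a subgroup of index 4 of the center. This gives 8|T| classes.
    Twisting by alpha permutes them without fixed points ([twisted_free]): if h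
    lies outside N and g phi(h) = h g, then h^2 is a nontrivial power of e1, which
    phi inverts, while g phi(h^2) = h^2 g says that phi fixes it. So the 8|T|
    classes are identified in pairs ([reidemeister_index2]).

    Every value 4n is attained by an automorphism with M = (n 1 ; 1 0)
    ([trace_auto]), and infinity by the identity. *)

Import GRing.Theory.

Set Implicit Arguments.
Unset Strict Implicit.
Unset Printing Implicit Defensive.

Local Open Scope group_scope.
Local Open Scope classical_set_scope.

(** * Twisted conjugacy *)

Section Morphisms.
Variables (G H : groupType) (f : G -> H).
Hypothesis fM : {morph f : x y / x * y}.

Lemma morphg1 : f 1 = 1.
Proof. by apply: (mulgI (f 1)); rewrite -fM !mulg1. Qed.

Lemma morphgV : {morph f : x / x^-1}.
Proof. by move=> x; apply/esym/mulg1_eq; rewrite -fM mulgV morphg1. Qed.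

End Morphisms.

Section TwistedConjugacy.
Variables (G : groupType) (phi : G -> G).
Hypothesis phiM : {morph phi : x y / x * y}.

Lemma twisted_conjE g g' :
  twisted_conj phi g g' <-> exists h, g * phi h = h * g'.
Proof.
split=> -[h e]; exists h; first by rewrite e mulgVK.
by rewrite -e mulgK.
Qed.

Lemma twisted_conj_refl g : twisted_conj phi g g.
Proof. by exists 1; rewrite (morphg1 phiM) invg1 mulg1 mul1g. Qed.

Lemma twisted_conj_sym g g' : twisted_conj phi g g' -> twisted_conj phi g' g.
Proof.
move=> [h ->]; exists h^-1.
by rewrite (morphgV phiM) invgK !mulgA mulVg mul1g mulgVK.
Qed.

Lemma twisted_conj_trans g1 g2 g3 :
  twisted_conj phi g1 g2 -> twisted_conj phi g2 g3 -> twisted_conj phi g1 g3.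
Proof.
move=> [h ->] [h' ->]; exists (h * h').
by rewrite phiM invgM !mulgA.
Qed.

Lemma twisted_class_eq g g' :
  twisted_class phi g = twisted_class phi g' <-> twisted_conj phi g g'.
Proof.
split=> [e|gg'].
  have : twisted_class phi g' g' by exact: twisted_conj_refl.
  by rewrite -e.
apply/seteqP; split=> x /=; apply: twisted_conj_trans => //.
exact: twisted_conj_sym.
Qed.

Lemma reidemeister_transversal (F : finType) (rep : F -> G) :
    (forall g, exists i, twisted_conj phi g (rep i)) ->
    (forall i j, twisted_conj phi (rep i) (rep j) -> i = j) ->
  reidemeister_number phi = (#|F|)%:E.
Proof.
move=> repS repI.
have rangeE : range (twisted_class phi) =
    [set` [fset twisted_class phi (rep i) | i in F]%fset].
  apply/seteqP; split=> A /=.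
    move=> [g _ <-]; have [i gi] := repS g.
    by apply/imfsetP; exists i => //; apply/twisted_class_eq.
  by move=> /imfsetP[i _ ->]; exists (rep i).
rewrite /reidemeister_number rangeE ifT; last by apply/asboolP; exact: finite_fset.
rewrite set_fsetK card_imfset/=; last by move=> i j /twisted_class_eq/repI.
by rewrite cardE; congr (size _)%:E.
Qed.

Lemma reidemeister_infinite (f : nat -> G) :
    (forall m n, twisted_conj phi (f m) (f n) -> m = n) ->
  reidemeister_number phi = +oo%E.
Proof.
move=> fI; rewrite /reidemeister_number ifF//; apply/asboolP => fin.
apply: infinite_nat.
rewrite -(@eq_finite_set _ _ (range (twisted_class phi \o f))).
  by apply: sub_finite_set fin => _ [n _ <-]; exists (f n).
by apply: inj_card_eq => m n _ _ /twisted_class_eq/fI.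
Qed.

Variables (sg : G -> bool) (a : G).
Hypothesis sgM : {morph sg : x y / x * y >-> x (+) y}.
Hypothesis sga : sg a.

(** Halving principle for the index-two subgroup N = ker sg: twisted
    conjugacy by N refines twisted conjugacy by G, and [rep] is a transversal
    of the finer relation. If no element outside N fixes a point (the first
    premise), then twisting by [a] induces an involution without fixed points
    on the N-classes, whose orbits are the G-classes. *)
Lemma reidemeister_index2 (F : finType) (rep : F -> G) :
    (forall g h, sg h -> g * phi h <> h * g) ->
    (forall g, exists i h, ~~ sg h /\ g * phi h = h * rep i) ->
    (forall i j h, ~~ sg h -> rep i * phi h = h * rep j -> i = j) ->
  exists2 n, #|F| = (2 * n)%N & reidemeister_number phi = n%:E.
Proof.
move=> free repS repI.
(* tau is the involution induced on the transversal by elements outside N. *)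
have /choice[tau tauP] : forall i, exists j, exists2 h,
    sg h & rep i * phi h = h * rep j.
  move=> i; have [j [h [sgh e]]] := repS (a^-1 * rep i * phi a).
  exists j, (a * h); first by rewrite sgM sga (negPf sgh).
  by rewrite phiM -[RHS]mulgA -e !mulgA mulgV mul1g.
have tauK : involutive tau.
  move=> i; have [h sh eh] := tauP i; have [h' sh' eh'] := tauP (tau i).
  apply/esym; apply: (repI _ _ (h * h')); first by rewrite sgM sh sh'.
  by rewrite phiM mulgA eh -!mulgA eh'.
have tau_neq i : tau i <> i.
  by move=> e; have [h sh] := tauP i; rewrite e; exact: free.
(* From each orbit {i, tau i} keep the index that is enumerated first. *)
pose lo := [set i | (enum_rank i < enum_rank (tau i))%N]%SET.
have loC : ~: lo = tau @^-1: lo.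
  apply/setP => i; rewrite !inE tauK -leqNgt leq_eqVlt.
  have /negPf-> // : enum_rank (tau i) != enum_rank i :> nat.
  by apply/eqP => /val_inj/enum_rank_inj/tau_neq.
exists #|lo|.
  by rewrite -(cardsC lo) loC card_preimset ?mul2n ?addnn//; exact: inv_inj.
have -> : #|lo| = #|{: {i | i \in lo}}| by rewrite card_sig.
apply: (@reidemeister_transversal _ (fun i => rep (val i))).
  move=> g; have [i [h [sh e]]] := repS g.
  have [il|iNl] := boolP (i \in lo).
    by exists (exist _ i il); apply/twisted_conjE; exists h.
  have til : tau i \in lo by rewrite -finset.in_setC loC inE in iNl.
  exists (exist _ (tau i) til); apply/twisted_conjE => /=.
  have [h' _ e'] := tauP i; exists (h * h').
  by rewrite phiM mulgA e -!mulgA e'.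
move=> [i il] [j jl] /twisted_conjE[h /= e]; apply/val_inj => /=.
have [sh|] := boolP (sg h); last by move=> sh; exact: repI e.
have [h' sh' e'] := tauP j.
have itj : i = tau j.
  apply: (repI _ _ (h * h')); first by rewrite sgM sh sh'.
  by rewrite phiM mulgA e -!mulgA e'.
have : j \in ~: lo by rewrite loC inE -itj.
by rewrite inE jl.
Qed.

End TwistedConjugacy.

Lemma reidemeister_conj (G H : groupType) (f : G -> H) (f' : H -> G)
    (phi : G -> G) (psi : H -> H) :
    {morph f : x y / x * y} -> cancel f f' -> cancel f' f ->
    (forall x, f (phi x) = psi (f x)) ->
  reidemeister_number psi = reidemeister_number phi.
Proof.
move=> fM fK f'K fphi.
have conjE g g' : twisted_conj psi (f g) (f g') <-> twisted_conj phi g g'.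
  split=> -[h e].
    exists (f' h); apply: (can_inj fK).
    by rewrite !fM (morphgV fM) fphi f'K.
  by exists (f h); rewrite e !fM (morphgV fM) fphi.
have imI : injective (fun A : set G => f @` A).
  move=> A B /= AB; apply/funext => x.
  by rewrite -[LHS](image_inj (can_inj fK)) AB image_inj//; exact: can_inj fK.
have rangeE : range (twisted_class psi) =
    (fun A => f @` A) @` range (twisted_class phi).
  have classE g : twisted_class psi (f g) = f @` twisted_class phi g.
    apply/seteqP; split=> [y|_ [x /= xg <-]] /=; last exact/conjE.
    by rewrite -[y]f'K => /conjE ?; exists (f' y).
  apply/seteqP; split=> [_ [y _ <-]|_ [_ [g _ <-] <-]].
    by exists (twisted_class phi (f' y)); [exists (f' y)|rewrite -classE f'K].
  by exists (f g).
have rangesE : (range (twisted_class psi) #= range (twisted_class phi))%card.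
  by rewrite rangeE; apply: inj_card_eq => A B _ _; exact: imI.
rewrite /reidemeister_number (eq_finite_set rangesE); case: ifP => // /asboolP fin.
have [n nE] := fin.
by rewrite !(@card_fset_set _ _ n)//; exact: card_eq_trans rangesE nE.
Qed.

(** Bare functions are easier to compose and to invert than bundled morphisms. *)
Lemma Spec_RE (G : groupType) : Spec_R G =
  [set reidemeister_number phi
    | phi in [set phi : G -> G | {morph phi : x y / x * y} /\ bijective phi]].
Proof.
apply/seteqP; split=> _ [phi /= phiP <-].
  by exists phi => //; split=> //; exact: gmulfM.
have [phiM bij] := phiP.
pose Phi : {multiplicative G -> G} :=
  HB.pack phi (isMultiplicative.Build G G phi phiM).
by exists Phi.
Qed.

Lemma Spec_R_isog (G H : groupType) (f : G -> H) :
  {morph f : x y / x * y} -> bijective f -> Spec_R G = Spec_R H.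
Proof.
move=> fM [f' fK f'K].
have f'M : {morph f' : x y / x * y}.
  by move=> x y; apply: (can_inj fK); rewrite fM !f'K.
rewrite !Spec_RE; apply/seteqP; split=> _ [phi [/= phiM phi_bij] <-].
  exists (f \o phi \o f').
    split=> [x y|] /=; first by rewrite f'M phiM fM.
    by apply: bij_comp; [apply: bij_comp => //|]; [exists f'|exists f].
  by apply: (reidemeister_conj fM fK f'K) => x /=; rewrite fK.
exists (f' \o phi \o f).
  split=> [x y|] /=; first by rewrite fM phiM f'M.
  by apply: bij_comp; [apply: bij_comp => //|]; [exists f|exists f'].
by apply: (reidemeister_conj f'M f'K fK) => x /=; rewrite f'K.
Qed.

(** * Groups given by generators and relations *)

Section PresentedUniversal.
Variables (X : choiceType) (rels : seq (word X * word X)) (H : groupType).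
Variable gen : X -> H.

Definition eval_letter (l : X * bool) : H :=
  if l.2 then (gen l.1)^-1 else gen l.1.
Definition eval_word (w : word X) : H := \prod_(l <- w) eval_letter l.

Lemma eval_wordM : {morph eval_word : u v / u * v}.
Proof. by move=> u v; rewrite /eval_word big_cat. Qed.

Lemma eval_wordV : {morph eval_word : u / u^-1}.
Proof.
elim=> [|[x b] w IHw]; first by rewrite /eval_word !big_nil invg1.
have -> : ((x, b) :: w : word X) = ([:: (x, b)] : word X) * w by [].
rewrite invgM !eval_wordM IHw invgM; congr (_ * _).
by rewrite /eval_word !big_seq1 /eval_letter; case: b; rewrite /= ?invgK.
Qed.

Lemma eval_word1 : eval_word 1 = 1.
Proof. exact: big_nil. Qed.

Lemma eval_word_gen x : eval_word (letter x) = gen x.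
Proof. by rewrite /eval_word big_seq1. Qed.

Hypothesis gen_rels :
  forall r, r \in rels -> eval_word r.1 = eval_word r.2.

Lemma eval_word_eq u v : pres_eq rels u v -> eval_word u = eval_word v.
Proof.
elim=> {u v} [u v /gen_rels //|x|x|u u' v v' _ eu _ ev|//|//|v u w _ -> _ //].
- by rewrite eval_wordM eval_wordV mulgV eval_word1.
- by rewrite eval_wordM eval_wordV mulVg eval_word1.
- by rewrite !eval_wordM eu ev.
Qed.

(** The existence half of the universal property: a map of the generators
    into [H] that respects the relations extends to a morphism. *)
Definition presented_lift (g : presented rels) : H := eval_word (repr g).

Lemma presented_liftE w : presented_lift (pres_class rels w) = eval_word w.
Proof. exact/eval_word_eq/pres_repr_class. Qed.

Lemma presented_liftM : {morph presented_lift : g h / g * h}.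
Proof.
move=> g h; rewrite -(pres_class_repr g) -(pres_class_repr h) -pres_classM.
by rewrite !presented_liftE eval_wordM.
Qed.

End PresentedUniversal.

Lemma presented_ind (X : choiceType) (rels : seq (word X * word X))
    (P : presented rels -> Prop) :
    P 1 -> (forall x g, P g -> P (pres_class rels (letter x) * g)) ->
    (forall x g, P g -> P ((pres_class rels (letter x))^-1 * g)) ->
  forall g, P g.
Proof.
move=> P1 PM PV g; rewrite -(pres_class_repr g).
elim: (repr g) => [|[x b] w IHw]; first exact: P1.
have -> : ((x, b) :: w : word X) = ([:: (x, b)] : word X) * w by [].
rewrite pres_classM; case: b; last exact: PM.
have -> : [:: (x, true)] = (letter x)^-1 by [].
by rewrite pres_classV; exact: PV.
Qed.

(** Unlike [int_rect], the steps start from an arbitrary integer. *)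
Lemma int_step_ind (P : int -> Prop) :
  P 0%R -> (forall n, P n -> P (n + 1)%R) -> (forall n, P n -> P (n - 1)%R) ->
  forall n, P n.
Proof.
move=> P0 PS PP; elim/int_rect => // n Pn.
  by rewrite -addn1 PoszD; exact: PS.
by rewrite -addn1 PoszD opprD; exact: PP.
Qed.

(** * Integer powers in a group *)

Section IntegerPowers.
Variable G : groupType.
Implicit Types (x y z : G) (m n : int).

Definition zpow x n := match n with Posz n => x ^+ n | Negz n => x ^- n.+1 end.

Lemma zpow0 x : zpow x 0 = 1. Proof. by []. Qed.

Lemma zpow1 x : zpow x 1 = x. Proof. by []. Qed.

Lemma zpowSr x n : zpow x (n + 1) = zpow x n * x.
Proof.
case: n => [n|[|n]].
- by rewrite -PoszD addn1 /= expgSr.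
- by rewrite /= expg1 mulVg.
- have -> : (Negz n.+1 + 1 = Negz n)%R by lia.
  by rewrite /= [x ^+ n.+2]expgS invgM mulgVK.
Qed.

Lemma zpowBr x n : zpow x (n - 1) = zpow x n * x^-1.
Proof. by rewrite -{2}(subrK 1%R n) zpowSr mulgK. Qed.

Lemma zpow_unique (f : int -> G) :
  (forall m n, f (m + n)%R = f m * f n) -> forall n, f n = zpow (f 1%R) n.
Proof.
move=> fD; have f0 : f 0%R = 1 by apply: (mulgI (f 0%R)); rewrite -fD addr0 mulg1.
apply: int_step_ind => // n IHn; first by rewrite fD IHn zpowSr.
have fN1 : f (-1)%R = (f 1%R)^-1 by apply/esym/mulg1_eq; rewrite -fD subrr f0.
by rewrite fD IHn zpowBr fN1.
Qed.

Lemma zpowD x m n : zpow x (m + n) = zpow x m * zpow x n.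
Proof.
elim/int_step_ind: n => [|n IHn|n IHn]; first by rewrite addr0 mulg1.
  by rewrite addrA !zpowSr IHn mulgA.
by rewrite addrA !zpowBr IHn mulgA.
Qed.

Lemma zpowA x m n : zpow x (m * n) = zpow (zpow x m) n.
Proof.
rewrite (@zpow_unique (fun n => zpow x (m * n))) ?mulr1// => i j.
by rewrite mulrDr zpowD.
Qed.

Lemma zpowN x n : zpow x (- n) = zpow x^-1 n.
Proof. by rewrite -mulN1r zpowA /= expg1. Qed.

(** Conjugation by [y] is a morphism, hence compatible with powers. *)
Lemma zpow_conj x x' y n : y * x = x' * y -> y * zpow x n = zpow x' n * y.
Proof.
move=> e; apply/(mulIg y^-1); rewrite mulgK.
rewrite (@zpow_unique (fun n => y * zpow x n * y^-1)) => [|i j].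
  by rewrite zpow1 e mulgK.
by rewrite zpowD !mulgA mulgVK.
Qed.

Lemma zpow_commute x y n : commute y x -> commute y (zpow x n).
Proof. exact: zpow_conj. Qed.

Lemma zpow_commute2 x y m n : commute y x -> commute (zpow y m) (zpow x n).
Proof.
by move=> c; apply: zpow_commute; apply/commute_sym/zpow_commute/commute_sym.
Qed.

Lemma zpowM x y n : commute x y -> zpow (x * y) n = zpow x n * zpow y n.
Proof.
move=> c; rewrite [RHS](@zpow_unique (fun n => zpow x n * zpow y n)) => [//|i j].
rewrite !zpowD !mulgA; congr (_ * _); rewrite -!mulgA; congr (_ * _).
exact: zpow_commute2.
Qed.

(** In a class-two group the commutator is bilinear: the exponents
    multiply. *)
Lemma zpow_swap x y z m n : commute z x -> commute z y -> y * x = z * x * y ->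
  zpow y m * zpow x n = zpow z (m * n) * zpow x n * zpow y m.
Proof.
move=> zx zy yx; set X := zpow x n; set Z := zpow z n.
have yX : y * X = Z * X * y by rewrite -zpowM//; exact: zpow_conj.
have ZX : commute Z X by exact: zpow_commute2.
have Zy : commute Z y by apply/commute_sym/zpow_commute/commute_sym.
have /(zpow_conj m) e : X^-1 * y = (Z * y) * X^-1.
  by apply/(mulgI X)/(mulIg X); rewrite mulVKg -!mulgA mulVg mulg1 yX !mulgA ZX.
have := congr1 (fun g => X * g * X) e.
rewrite mulVKg mulgA mulgVK => ->.
rewrite zpowM// [(m * n)%R]mulrC zpowA mulgA; congr (_ * _).
exact/zpow_commute/commute_sym.
Qed.

End IntegerPowers.

Lemma morph_zpow (G H : groupType) (f : G -> H) x n :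
  {morph f : x y / x * y} -> f (zpow x n) = zpow (f x) n.
Proof.
move=> fM; rewrite (@zpow_unique _ (fun n => f (zpow x n))) ?zpow1// => i j.
by rewrite zpowD fM.
Qed.

(** * The model of the group on Z^4 *)

(** This is (-1)^n, with n possibly negative. *)
Definition parity_sign (n : int) : int := if (2 %| n)%Z then 1%R else (- 1)%R.

Lemma parity_signD m n :
  parity_sign (m + n) = (parity_sign m * parity_sign n)%R.
Proof. by rewrite /parity_sign; do !case: ifP; lia. Qed.

Lemma parity_signS n : parity_sign (n + 1) = (- parity_sign n)%R.
Proof. by rewrite parity_signD mulrN1. Qed.

Lemma parity_signB1 n : parity_sign (n - 1) = (- parity_sign n)%R.
Proof. by rewrite parity_signD mulrN1. Qed.

Lemma parity_signM4 m n : parity_sign (m + 4 * n) = parity_sign m.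
Proof. by rewrite /parity_sign; congr (if _ then _ else _); lia. Qed.

Lemma parity_signP n : parity_sign n = 1%R \/ parity_sign n = (- 1)%R.
Proof. by rewrite /parity_sign; case: ifP; [left|right]. Qed.

Lemma parity_signN n : parity_sign (- n) = parity_sign n.
Proof. by rewrite /parity_sign; congr (if _ then _ else _); lia. Qed.

Local Notation sgn := parity_sign.

Definition model (k : nat) : Type := (int * int * int * int)%type.
HB.instance Definition _ k := Choice.on (model k).

Section Model.
Variable k : nat.
Local Notation M := (model k).

(** The normal form alpha^a e2^b e3^c e4^d. *)
Definition mk (a b c d : int) : M := (a, b, c, d).

(** Moving alpha^a' to the left inverts e3 and e4 when a' is odd, and
    e4^d e3^c' = e1^(2kdc') e3^c' e4^d with e1 = alpha^2 gives the term 4k in the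
    first coordinate. *)
Definition model_mul (g h : M) : M :=
  let: (a, b, c, d) := g in let: (a', b', c', d') := h in
  mk (a + a' + 4 * (k%:Z * sgn a' * d * c')) (b + b')
     (sgn a' * c + c') (sgn a' * d + d').
Definition model_inv (g : M) : M :=
  let: (a, b, c, d) := g in
  mk (- a + 4 * (k%:Z * c * d)) (- b) (- (sgn a * c)) (- (sgn a * d)).

Fact model_mulA : associative model_mul.
Proof.
move=> [[[a b] c] d] [[[a' b'] c'] d'] [[[a'' b''] c''] d''].
rewrite /model_mul /mk !parity_signM4 !parity_signD.
by case: (parity_signP a'') => ->; congr (_, _, _, _); ring.
Qed.

Fact model_mul1g : left_id (mk 0 0 0 0) model_mul.
Proof. by move=> [[[a b] c] d]; congr (_, _, _, _); ring. Qed.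

Fact model_mulg1 : right_id (mk 0 0 0 0) model_mul.
Proof.
move=> [[[a b] c] d]; rewrite /= /mk; have -> : sgn 0 = 1%R by [].
by congr (_, _, _, _); ring.
Qed.

Fact model_mulVg : left_inverse (mk 0 0 0 0) model_inv model_mul.
Proof.
move=> [[[a b] c] d]; rewrite /= /mk.
by case: (parity_signP a) => ->; congr (_, _, _, _); ring.
Qed.

Fact model_mulgV : right_inverse (mk 0 0 0 0) model_inv model_mul.
Proof.
move=> [[[a b] c] d]; rewrite /= /mk parity_signM4 parity_signN.
by case: (parity_signP a) => ->; congr (_, _, _, _); ring.
Qed.

HB.instance Definition _ := isGroup.Build M
  model_mulA model_mul1g model_mulg1 model_mulVg model_mulgV.

Lemma mkM a b c d a' b' c' d' : mk a b c d * mk a' b' c' d' =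
  mk (a + a' + 4 * (k%:Z * sgn a' * d * c')) (b + b')
     (sgn a' * c + c') (sgn a' * d + d').
Proof. by []. Qed.

End Model.

(** * The presented group is the model *)

Section NormalForm.
Variables (k : nat) (G : groupType) (x1 x2 x3 x4 y : G).
Hypotheses (c23 : commute x2 x3) (c24 : commute x2 x4) (c2y : commute x2 y).
Hypotheses (c13 : commute x1 x3) (c14 : commute x1 x4).
Hypotheses (y3 : y * x3 = x3^-1 * y) (y4 : y * x4 = x4^-1 * y).
Hypotheses (yy : y * y = x1) (x43 : x4 * x3 = x1 ^+ (2 * k) * x3 * x4).

Definition normal_form (g : model k) : G :=
  let: (a, b, c, d) := g in zpow y a * zpow x2 b * zpow x3 c * zpow x4 d.

Lemma zpow_alpha x a n : y * x = x^-1 * y ->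
  zpow x n * zpow y a = zpow y a * zpow x (sgn a * n)%R.
Proof.
move=> yx.
have yxn m : y * zpow x m = zpow x (- m) * y by rewrite zpowN; exact: zpow_conj.
elim/int_step_ind: a => [|a IHa|a IHa].
- by rewrite mulg1 mul1g mul1r.
- by rewrite zpowSr mulgA IHa parity_signS -!mulgA yxn mulNr opprK.
- rewrite zpowBr mulgA IHa parity_signB1 -!mulgA mulNr; congr (_ * _).
  by apply: (mulgI y); apply: (mulIg y); rewrite mulVKg mulgA mulgVK yxn.
Qed.

Lemma zpow_heisenberg c d : zpow x4 d * zpow x3 c =
  zpow y (4 * (k%:Z * d * c)) * zpow x3 c * zpow x4 d.
Proof.
have -> : zpow y (4 * (k%:Z * d * c)) = zpow (x1 ^+ (2 * k)) (d * c).
  have -> : x1 ^+ (2 * k) = zpow (zpow y 2) (2 * k)%N by rewrite -yy.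
  by rewrite -!zpowA; congr zpow; rewrite PoszM; ring.
by apply: zpow_swap => //; apply/commute_sym/commuteX/commute_sym.
Qed.

(** The relations suffice to multiply normal forms as the model does; the
    presented group is then exhausted by normal forms. *)
Lemma normal_formM : {morph normal_form : g h / g * h}.
Proof.
move=> [[[a b] c] d] [[[a' b'] c'] d'].
rewrite -[(a, b, c, d)]/(mk k a b c d) -[(a', b', c', d')]/(mk k a' b' c' d').
rewrite mkM /normal_form /mk.
set s := sgn a'; set n := (4 * _)%R.
have c2 x u v : commute x2 x -> zpow x u * zpow x2 v = zpow x2 v * zpow x u.
  by move=> cx; apply/zpow_commute2.
rewrite -!mulgA.
(* Collect the powers of y on the left, then those of x2. *)
rewrite (mulgA (zpow x4 d) (zpow y a')) (zpow_alpha _ _ y4).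
rewrite (mulgA (zpow x3 c)) (mulgA (zpow x3 c)) (zpow_alpha _ _ y3).
rewrite -!mulgA (mulgA (zpow x2 b) (zpow y a')) -(c2 y)// -!mulgA.
rewrite (mulgA (zpow x4 _) (zpow x2 b')) (c2 x4)// -!mulgA.
rewrite (mulgA (zpow x3 _) (zpow x2 b')) (c2 x3)// -!mulgA.
rewrite (mulgA (zpow x4 _) (zpow x3 c')) zpow_heisenberg -!mulgA.
have -> : (4 * (k%:Z * (sgn a' * d) * c'))%R = n by rewrite /n; ring.
rewrite (mulgA (zpow x3 _) (zpow y n)) (zpow_alpha _ _ y3) -!mulgA.
have -> : sgn n = 1%R by rewrite -[n]add0r parity_signM4.
rewrite mul1r (mulgA (zpow x2 b') (zpow y n)) -(c2 y)// -!mulgA.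
rewrite (mulgA (zpow x2 b) (zpow y n)) -(c2 y)// !mulgA.
by rewrite !zpowD !mulgA.
Qed.

End NormalForm.

Section GammaModel.
Variable k : nat.

Definition model_gen (i : 'I_5) : model k :=
  nth (mk k 1 0 0 0)
    [:: mk k 2 0 0 0; mk k 0 1 0 0; mk k 0 0 1 0; mk k 0 0 0 1] i.

Lemma mk_zpow (f : int -> model k) :
  (forall m n, f (m + n)%R = f m * f n) -> forall n, zpow (f 1%R) n = f n.
Proof. by move=> fD n; rewrite -zpow_unique. Qed.

Lemma zpow_mk1 n : zpow (mk k 1 0 0 0) n = mk k n 0 0 0.
Proof.
by apply: (mk_zpow (f := fun n => mk k n 0 0 0)) => i j; rewrite mkM; congr mk; ring.
Qed.

Lemma zpow_mk2 n : zpow (mk k 0 1 0 0) n = mk k 0 n 0 0.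
Proof.
apply: (mk_zpow (f := fun n => mk k 0 n 0 0)) => i j.
by rewrite mkM; congr mk; ring.
Qed.

Lemma zpow_mk3 n : zpow (mk k 0 0 1 0) n = mk k 0 0 n 0.
Proof.
apply: (mk_zpow (f := fun n => mk k 0 0 n 0)) => i j.
by rewrite mkM (_ : sgn 0 = 1%R)//; congr mk; ring.
Qed.

Lemma zpow_mk4 n : zpow (mk k 0 0 0 1) n = mk k 0 0 0 n.
Proof.
apply: (mk_zpow (f := fun n => mk k 0 0 0 n)) => i j.
by rewrite mkM (_ : sgn 0 = 1%R)//; congr mk; ring.
Qed.

Lemma model_gen_rels r : r \in Gamma_rels k ->
  eval_word model_gen r.1 = eval_word model_gen r.2.
Proof.
have ewX w n : eval_word model_gen (w ^+ n) = eval_word model_gen w ^+ n.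
  by elim: n => [|n IHn]; rewrite ?eval_word1// !expgS eval_wordM IHn.
have e1X : eval_word model_gen e1 ^+ (2 * k) = mk k (4 * k%:Z) 0 0 0.
  rewrite eval_word_gen -[model_gen _]/(mk k 2 0 0 0).
  have -> : mk k 2 0 0 0 = zpow (mk k 1 0 0 0) 2 by rewrite zpow_mk1.
  rewrite -[LHS]/(zpow (zpow (mk k 1 0 0 0) 2) (2 * k)%N) -zpowA zpow_mk1.
  by congr mk; rewrite PoszM; ring.
rewrite /Gamma_rels !inE => rP.
do !(case/orP: rP => [/eqP->|rP]); last move/eqP: rP => ->;
  rewrite /= /commutator ?eval_wordM ?ewX ?e1X ?eval_wordM ?eval_wordV
          ?eval_word1 ?eval_word_gen //.
all: congr (_, _, _, _); rewrite /= ?parity_signM4; ring.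
Qed.

(** The generators define a morphism f to the model. Its section S, the
    normal form, is a morphism whose image contains the generators, so S is onto
    and the two maps are mutually inverse. *)
Lemma Gamma_isog : exists2 f : Gamma k -> model k,
  {morph f : g h / g * h} & bijective f.
Proof.
pose f : Gamma k -> model k := presented_lift model_gen.
have fM : {morph f : g h / g * h} by exact: presented_liftM model_gen_rels.
have fE w : f (pres_class _ w) = eval_word model_gen w.
  exact: presented_liftE model_gen_rels w.
exists f => //.
pose c w : Gamma k := pres_class (Gamma_rels k) w.
have cM u v : c (u * v) = c u * c v by exact: pres_classM.
have cV u : c u^-1 = (c u)^-1 by exact: pres_classV.
have cX u n : c (u ^+ n) = c u ^+ n.
  by elim: n => // n IHn; rewrite !expgS cM IHn.
have rel u v : (u, v) \in Gamma_rels k -> c u = c v.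
  by move=> uv; apply/pres_classP; exact: PresRel.
have comm u v : (commutator u v, 1) \in Gamma_rels k -> commute (c v) (c u).
  move=> /rel; rewrite /commutator !cM !cV => /divg1_eq e.
  by rewrite /commute -{1}e mulgVK.
have c13 : commute (c e1) (c e3) by apply: comm; rewrite !inE eqxx ?orbT.
have c14 : commute (c e1) (c e4) by apply: comm; rewrite !inE eqxx ?orbT.
have c23 : commute (c e2) (c e3) by apply: comm; rewrite !inE eqxx ?orbT.
have c24 : commute (c e2) (c e4) by apply: comm; rewrite !inE eqxx ?orbT.
have x43 : c e4 * c e3 = c e1 ^+ (2 * k) * c e3 * c e4.
  have : c (commutator e4 e3) = c (e1 ^+ (2 * k)).
    by apply: rel; rewrite !inE eqxx ?orbT.
  by rewrite /commutator !cM !cV cX => <-; rewrite !mulgVK.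
have c2y : commute (c e2) (c alpha).
  by apply/esym; rewrite -!cM; apply: rel; rewrite !inE eqxx ?orbT.
have y3 : c alpha * c e3 = (c e3)^-1 * c alpha.
  by rewrite -cV -!cM; apply: rel; rewrite !inE eqxx ?orbT.
have y4 : c alpha * c e4 = (c e4)^-1 * c alpha.
  by rewrite -cV -!cM; apply: rel; rewrite !inE eqxx ?orbT.
have yy : c alpha * c alpha = c e1.
  by rewrite -cM; apply: rel; rewrite !inE eqxx ?orbT.
pose S : model k -> Gamma k := normal_form (c e2) (c e3) (c e4) (c alpha).
have SM : {morph S : g h / g * h}.
  exact: (normal_formM c23 c24 c2y c13 c14 y3 y4 yy x43).
have fS : cancel S f.
  move=> [[[a b] d] d']; rewrite /S /normal_form !fM !(morph_zpow _ _ fM) !fE.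
  rewrite !eval_word_gen /= zpow_mk1 zpow_mk2 zpow_mk3 zpow_mk4 !mkM /sgn /=.
  by congr mk; ring.
have Ssurj g : exists h, g = S h.
  have Sgen i : exists h, c (letter i) = S h.
    case: i => -[|[|[|[|[|//]]]]] lt5.
    - exists (mk k 2 0 0 0).
      rewrite /S /normal_form /mk /= expg0 !mulg1 expg2 yy.
      by congr (c (letter _)); exact: val_inj.
    - exists (mk k 0 1 0 0); rewrite /S /normal_form /mk /= !expg0 !mulg1 mul1g.
      by rewrite expg1; congr (c (letter _)); exact: val_inj.
    - exists (mk k 0 0 1 0); rewrite /S /normal_form /mk /= !expg0 !mulg1 !mul1g.
      by rewrite expg1; congr (c (letter _)); exact: val_inj.
    - exists (mk k 0 0 0 1); rewrite /S /normal_form /mk /= !expg0 !mul1g.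
      by rewrite expg1; congr (c (letter _)); exact: val_inj.
    - exists (mk k 1 0 0 0); rewrite /S /normal_form /mk /= !expg0 !mulg1.
      by rewrite expg1; congr (c (letter _)); exact: val_inj.
  elim/presented_ind: g => [|i g [h ->]|i g [h ->]].
  - by exists 1; rewrite (morphg1 SM).
  - by have [h' e] := Sgen i; exists (h' * h); rewrite SM -e.
  - by have [h' e] := Sgen i; exists (h'^-1 * h); rewrite SM (morphgV SM) -e.
exists S => // g; have [h ->] := Ssurj g.
by rewrite fS.
Qed.

End GammaModel.

(** * Cosets of a planar lattice *)

Local Open Scope ring_scope.

(** Let g = gcd(p, q), p = p' g and q = q' g. A unimodular change of basis
    brings the lattice to the lower triangular form generated by (g, c) and
    (0, D) with g D = det, so the points (i, j) with 0 <= i < |g| and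
    0 <= j < |D| represent each coset once. *)
Lemma lattice_transversal (p q r s : int) : p * s - q * r != 0 ->
  exists (F : finType) (rep : F -> int * int),
  [/\ #|F| = `|(p * s - q * r)%R|%N,
      forall v, exists i w1 w2,
        v.1 = (rep i).1 + (p * w1 + q * w2) /\
        v.2 = (rep i).2 + (r * w1 + s * w2)
    & forall i j w1 w2,
        (rep i).1 = (rep j).1 + (p * w1 + q * w2) ->
        (rep i).2 = (rep j).2 + (r * w1 + s * w2) -> i = j].
Proof.
move=> det0; have [u [v uv]] : exists u v, u * p + v * q = gcdz p q.
  by have [u [v e]] := Bezoutz p q; exists u, v.
have [p' pE] : exists p', p = p' * gcdz p q by apply/dvdzP; exact: dvdz_gcdl.
have [q' qE] : exists q', q = q' * gcdz p q by apply/dvdzP; exact: dvdz_gcdr.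
move: (gcdz p q) uv pE qE => g uv pE qE.
pose D := p' * s - q' * r; pose c := r * u + s * v.
have detE : p * s - q * r = g * D by rewrite pE qE /D; ring.
have /andP[g0 D0] : (g != 0) && (D != 0).
  by rewrite -negb_or -mulf_eq0 -detE.
have uv1 : u * p' + v * q' = 1.
  by apply: (mulIf g0); rewrite mul1r -[RHS]uv pE qE; ring.
exists ('I_`|g| * 'I_`|D|)%type.
exists (fun i : 'I_`|g| * 'I_`|D| => (Posz i.1, Posz i.2)); split.
- by rewrite card_prod !card_ord detE abszM.
- move=> [v1 v2] /=.
  pose x := (v1 %/ g)%Z; pose y := ((v2 - c * x)%R %/ D)%Z.
  have lt1 : (`|(v1 %% g)%Z| < `|g|)%N by move: g0; clear; lia.
  have lt2 : (`|((v2 - c * x)%R %% D)%Z| < `|D|)%N.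
    by move: (v2 - c * x) D0 => z; clear; lia.
  exists (Ordinal lt1, Ordinal lt2), (u * x - q' * y), (v * x + p' * y) => /=.
  rewrite !gez0_abs ?modz_ge0//; split.
    rewrite [LHS](divz_eq v1 g) -/x addrC pE qE; congr (_ + _).
    by rewrite -[LHS]mul1r -uv1; ring.
  have -> : r * (u * x - q' * y) + s * (v * x + p' * y) = y * D + c * x.
      by rewrite /c /D; ring.
    by rewrite addrA [_ + y * D]addrC -divz_eq subrK.
- move=> [i1 i2] [j1 j2] w1 w2 /=.
  pose x := p' * w1 + q' * w2; pose y := u * w2 - v * w1.
  have -> : p * w1 + q * w2 = g * x by rewrite pE qE /x; ring.
  have -> : r * w1 + s * w2 = c * x + D * y.
    by rewrite -[LHS]mul1r -uv1 /c /x /D /y; ring.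
  move=> e1; have x0 : x = 0.
    by move: (ltn_ord i1) (ltn_ord j1) e1; clear; nia.
  rewrite x0 mulr0 addr0 in e1; rewrite x0 mulr0 add0r => e2.
  have y0 : y = 0 by move: (ltn_ord i2) (ltn_ord j2) e2; clear; nia.
  rewrite y0 mulr0 addr0 in e2.
  by congr (_, _); apply: val_inj; [case: e1|case: e2].
Qed.

(** * Automorphisms of the model *)

Lemma sgn_even a : (2 %| a)%Z -> sgn a = 1.
Proof. by rewrite /sgn => ->. Qed.

Lemma sgn_odd a : ~~ (2 %| a)%Z -> sgn a = -1.
Proof. by rewrite /sgn => /negPf->. Qed.

Lemma sgn2 i : sgn (2 * i) = 1.
Proof. by apply: sgn_even; lia. Qed.

Lemma sgn4 i : sgn (4 * i) = 1.
Proof. by apply: sgn_even; lia. Qed.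

Definition sgnE := (parity_signM4, sgn4, parity_signD, sgn2).

Lemma unit_pm1 (a b : int) : a * b = 1 -> a = 1 \/ a = -1.
Proof.
move=> ab; have : (`|a|%N * `|b|%N)%N = 1%N by rewrite -abszM ab.
by move/eqP; rewrite muln_eq1 => /andP[/eqP a1 _]; lia.
Qed.

Section Shape.
Variable k : nat.
Local Notation M := (model k).
Local Notation mk := (mk k).

Definition is_odd (g : M) : bool := ~~ (2 %| g.1.1.1)%Z.

Lemma is_oddE a b c d : is_odd (mk a b c d) = ~~ (2 %| a)%Z.
Proof. by []. Qed.

Lemma is_oddM : {morph is_odd : g h / (g * h)%g >-> g (+) h}.
Proof.
move=> [[[a b] c] d] [[[a' b'] c'] d']; rewrite /is_odd /=.
by move: (_ * c') => z; lia.
Qed.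

Lemma mkV a b c d : (mk a b c d)^-1%g =
  mk (- a + 4 * (k%:Z * c * d)) (- b) (- (sgn a * c)) (- (sgn a * d)).
Proof. by []. Qed.

Lemma mk_inj a b c d a' b' c' d' : mk a b c d = mk a' b' c' d' ->
  [/\ a = a', b = b', c = c' & d = d'].
Proof. by case. Qed.

Lemma centralP (g : M) : (forall h, commute g h) <->
  exists i b, g = mk (2 * i) b 0 0.
Proof.
split=> [|[i [b ->]] [[[a' b'] c'] d']]; last first.
  rewrite /commute -[(a', b', c', d')]/(mk a' b' c' d') !mkM sgn2.
  by congr mk; ring.
case: g => [[[a b] c] d]; rewrite -[(a, b, c, d)]/(mk a b c d) => cg.
have := cg (mk 1 0 0 0); rewrite /commute !mkM => /mk_inj[_ _].
have -> : sgn 1 = -1 by []. move=> c0 d0.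
have := cg (mk 0 0 1 0); rewrite /commute !mkM => /mk_inj[_ _ s1 _].
have a2 : (2 %| a)%Z.
  by apply: contraT => /sgn_odd; move: s1 c0 d0; have -> : sgn 0 = 1 by []; lia.
have [i iE] := dvdzP a2; exists i, b; rewrite iE.
by congr mk; move: c0 d0; clear; lia.
Qed.

Lemma even_mk (g : M) : ~~ is_odd g -> exists i b c d, g = mk (2 * i) b c d.
Proof.
case: g => [[[a b] c] d]; rewrite /is_odd negbK => /dvdzP[i /= ->].
by exists i, b, c, d; rewrite mulrC.
Qed.

Lemma odd_mk (g : M) : is_odd g ->
  exists i b c d, g = (mk (2 * i) b c d * mk 1 0 0 0)%g.
Proof.
case: g => [[[a b] c] d] ao; have : exists i, a = 2 * i + 1.
  by exists (a %/ 2)%Z; move: ao; rewrite /is_odd /=; lia.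
move=> [i ->]; exists i, b, (- c), (- d).
by rewrite mkM (_ : sgn 1 = -1)//; congr (_, _, _, _); ring.
Qed.

Lemma zpow_central i b n : zpow (mk (2 * i) b 0 0) n = mk (2 * (i * n)) (b * n) 0 0.
Proof.
rewrite -[i in LHS]mulr1 -[b in LHS]mulr1.
apply: (mk_zpow (f := fun n => mk (2 * (i * n)) (b * n) 0 0)) => m m'.
by rewrite mkM; congr mk; ring.
Qed.

(** The powers of an element of N are computed coordinatewise up to e1^2,
    because commutators in N are powers of e1^(2k). *)
Lemma zpow_even i b c d n : exists j,
  zpow (mk (2 * i) b c d) n = mk (2 * (i * n) + 4 * j) (b * n) (c * n) (d * n).
Proof.
elim/int_step_ind: n => [|n [j IHn]|n [j IHn]].
- by exists 0; rewrite zpow0 !mulr0.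
- exists (j + k%:Z * (d * n) * c); rewrite zpowSr IHn mkM sgn2.
  by congr mk; ring.
- exists (j + k%:Z * c * d - k%:Z * (d * n) * c).
  rewrite zpowBr IHn mkV mkM parity_signM4 parity_signN sgn2.
  by congr mk; ring.
Qed.

Section Automorphism.
Variables phi psi : M -> M.
Hypothesis phiM : {morph phi : g h / (g * h)%g}.
Hypothesis psiK : cancel psi phi.

Lemma auto_central i b : exists i' b', phi (mk (2 * i) b 0 0) = mk (2 * i') b' 0 0.
Proof.
apply/centralP => h; rewrite -[h]psiK /commute -!phiM; congr phi.
by apply: (centralP (mk (2 * i) b 0 0)).2; exists i, b.
Qed.

End Automorphism.

(** If g lies in N but phi g does not, then (phi g)^2 is central, so g^2 is
    central too. This forces g to be central, hence phi g to be central: but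
    central elements lie in N. *)
Lemma auto_even (phi psi : M -> M) (g : M) :
  {morph phi : g h / (g * h)%g} -> {morph psi : g h / (g * h)%g} ->
  cancel phi psi -> cancel psi phi -> ~~ is_odd g -> ~~ is_odd (phi g).
Proof.
move=> phiM psiM phiK psiK ge; apply/negP.
case phigE: (phi g) => [[[a b] c] d] ao.
have [j [b' gg]] : exists j b', (phi g * phi g)%g = mk (2 * j) b' 0 0.
  rewrite phigE -[(a, b, c, d)]/(mk a b c d) mkM (sgn_odd ao).
  exists (a + 2 * (k%:Z * -1 * d * c)), (b + b).
  by congr mk; ring.
have [i [b'' ]] := auto_central psiM phiK j b'.
rewrite -gg -phiM phiK.
case: g ge {gg} phigE => [[[a0 b0] c0] d0] ge phigE.
rewrite -[(_, _, _, _)]/(mk a0 b0 c0 d0) mkM sgn_even; last first.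
  by rewrite /is_odd negbK in ge.
move=> /mk_inj[_ _ cc dd].
have [i0 i0E] : exists i, a0 = i * 2 by apply/dvdzP; rewrite /is_odd negbK in ge.
have [i1 [b1]] := auto_central phiM psiK i0 b0.
have -> : mk (2 * i0) b0 0 0 = (a0, b0, c0, d0).
  by congr (_, _, _, _); move: cc dd i0E; clear; lia.
rewrite phigE => -[aE _ _ _]; move: ao; rewrite /is_odd aE /=; lia.
Qed.

(** The action of an automorphism: (p q ; r s) is its matrix on N / center,
    and the exponents [u] and [v] of e1 in the images of e3 and e4 only matter
    modulo e1^2, which is what [j] absorbs in [shape_even]. *)
Record auto_shape (phi : M -> M) (D eps t p q r s u v m n x : int) : Prop :=
  AutoShape {
    shape_det : D = p * s - q * r;
    shape_D : D = 1 \/ D = -1;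
    shape_eps : eps = 1 \/ eps = -1;
    shape_odd g : is_odd (phi g) = is_odd g;
    shape_center i b : phi (mk (2 * i) b 0 0) = mk (2 * (D * i + t * b)) (eps * b) 0 0;
    shape_alpha : phi (mk 1 0 0 0) = mk x 0 m n;
    shape_even b c d : exists j, forall i, phi (mk (2 * i) b c d) =
      mk (2 * (D * i + t * b + u * c + v * d) + 4 * j) (eps * b)
         (p * c + q * d) (r * c + s * d) }.

Lemma auto_parity (phi psi : M -> M) (g : M) :
  {morph phi : g h / (g * h)%g} -> {morph psi : g h / (g * h)%g} ->
  cancel phi psi -> cancel psi phi -> is_odd (phi g) = is_odd g.
Proof.
move=> phiM psiM phiK psiK; apply: negb_inj.
apply/idP/idP; last exact: auto_even phiM psiM phiK psiK.
by rewrite -{2}[g]phiK; exact: auto_even psiM phiM psiK phiK.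
Qed.

Hypothesis k_gt0 : (0 < k)%N.

(** Comparing the images of both sides of e4 e3 = e1^(2k) e3 e4 yields the
    exponent D = det of phi e1, as well as the absence of e2 from phi e1. *)
Lemma auto_generators (phi psi : M -> M) :
  {morph phi : g h / (g * h)%g} -> {morph psi : g h / (g * h)%g} ->
  cancel phi psi -> cancel psi phi ->
  exists D t eps u b3 p r v b4 q s,
  [/\ D = p * s - q * r,
      forall i b, phi (mk (2 * i) b 0 0) = mk (2 * (D * i + t * b)) (eps * b) 0 0,
      phi (mk 0 0 1 0) = mk (2 * u) b3 p r
    & phi (mk 0 0 0 1) = mk (2 * v) b4 q s].
Proof.
move=> phiM psiM phiK psiK.
have phi_odd g := auto_parity g phiM psiM phiK psiK.
have [D [eD phi1]] := auto_central phiM psiK 1 0.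
have [t [eps phi2]] := auto_central phiM psiK 0 1.
have [u [b3 [p [r phi3]]]] : exists u b c d, phi (mk 0 0 1 0) = mk (2 * u) b c d.
  by apply: even_mk; rewrite phi_odd.
have [v [b4 [q [s phi4]]]] : exists v b c d, phi (mk 0 0 0 1) = mk (2 * v) b c d.
  by apply: even_mk; rewrite phi_odd.
have phi_z i : phi (mk (2 * i) 0 0 0) = mk (2 * (D * i)) (eD * i) 0 0.
  have -> : mk (2 * i) 0 0 0 = zpow (mk (2 * 1) 0 0 0) i.
    by rewrite zpow_central mul1r mul0r.
  by rewrite (morph_zpow _ _ phiM) phi1 zpow_central.
have : phi (mk 0 0 0 1 * mk 0 0 1 0)%g =
       phi (mk (2 * (2 * k%:Z)) 0 0 0 * (mk 0 0 1 0 * mk 0 0 0 1))%g.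
  by congr phi; rewrite !mkM /=; congr mk; ring.
rewrite !phiM phi_z phi3 phi4 !mkM !sgn2 => /mk_inj[Da eDb _ _].
have eD0 : eD = 0 by move: eDb k_gt0; clear; nia.
have detE : D = p * s - q * r.
  apply: (mulfI (_ : 4 * k%:Z != 0)); first by move: k_gt0; clear; lia.
  move: Da; clear; set X := 2 * u; lia.
exists D, t, eps, u, b3, p, r, v, b4, q, s; split=> // i b.
have -> : mk (2 * i) b 0 0 = (mk (2 * i) 0 0 0 * zpow (mk (2 * 0) 1 0 0) b)%g.
  by rewrite zpow_central mkM; congr mk; ring.
rewrite phiM phi_z eD0 (morph_zpow _ _ phiM) phi2 zpow_central mkM !sgn2.
by congr mk; ring.
Qed.

(** D and eps are invertible because the inverse of phi has such exponents
    too. The e2-exponents of the images of alpha, e3 and e4 vanish by alpha^2 =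
    e1 and since alpha inverts e3 and e4. *)
Lemma auto_shapeP (phi : M -> M) :
  {morph phi : g h / (g * h)%g} -> bijective phi ->
  exists D eps t p q r s u v m n x, auto_shape phi D eps t p q r s u v m n x.
Proof.
move=> phiM [psi phiK psiK].
have psiM : {morph psi : g h / (g * h)%g}.
  by move=> g h; apply: (can_inj phiK); rewrite phiM !psiK.
have [D [t [eps [u [b3 [p [r [v [b4 [q [s]]]]]]]]]]] :=
  auto_generators phiM psiM phiK psiK.
move=> [detE phiz phi3 phi4].
have [D' [t' [eps' [? [? [? [? [? [? [? [? [_ psiz _ _]]]]]]]]]]]] :=
  auto_generators psiM phiM psiK phiK.
have := psiK (mk (2 * 1) 0 0 0); rewrite psiz phiz => /mk_inj[DD _ _ _].
have := psiK (mk (2 * 0) 1 0 0); rewrite psiz phiz => /mk_inj[_ ee _ _].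
have phi_odd g := auto_parity g phiM psiM phiK psiK.
case phiy : (phi (mk 1 0 0 0)) => [[[x y] m] n].
rewrite -[(_, _, _, _)]/(mk x y m n) in phiy.
have y0 : y = 0.
  have := phiM (mk 1 0 0 0) (mk 1 0 0 0).
  have -> : (mk 1 0 0 0 * mk 1 0 0 0)%g = mk (2 * 1) 0 0 0.
    by rewrite mkM; congr mk; ring.
  by rewrite phiz phiy mkM => /mk_inj[_ + _ _]; lia.
have b30 : b3 = 0.
  have : phi (mk 1 0 0 0 * mk 0 0 1 0)%g = phi ((mk 0 0 1 0)^-1 * mk 1 0 0 0)%g.
    by congr phi; rewrite mkV !mkM; congr mk; ring.
  by rewrite !phiM (morphgV phiM) phi3 phiy mkV !mkM => /mk_inj[_ + _ _]; lia.
have b40 : b4 = 0.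
  have : phi (mk 1 0 0 0 * mk 0 0 0 1)%g = phi ((mk 0 0 0 1)^-1 * mk 1 0 0 0)%g.
    by congr phi; rewrite mkV !mkM; congr mk; ring.
  by rewrite !phiM (morphgV phiM) phi4 phiy mkV !mkM => /mk_inj[_ + _ _]; lia.
subst y b3 b4.
exists D, eps, t, p, q, r, s, u, v, m, n, x; split=> //.
- have /unit_pm1 : D * D' = 1 by move: DD; clear; lia.
  by [].
- have /unit_pm1 : eps * eps' = 1 by move: ee; clear; lia.
  by [].
- move=> b c d.
  have [j3 e3j] := zpow_even u 0 p r c; have [j4 e4j] := zpow_even v 0 q s d.
  exists (j3 + j4 + k%:Z * (r * c) * (q * d)) => i.
  have -> : mk (2 * i) b c d =
      (mk (2 * i) b 0 0 * (zpow (mk 0 0 1 0) c * zpow (mk 0 0 0 1) d))%g.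
    by rewrite zpow_mk3 zpow_mk4 !mkM (_ : sgn 0 = 1)//; congr mk; ring.
  rewrite !phiM !(morph_zpow _ _ phiM) phiz phi3 phi4 e3j e4j.
  rewrite !mkM !(parity_signM4, parity_signD, sgn2).
  by congr mk; ring.
Qed.

End Shape.

(** * Automorphisms with infinitely many twisted classes *)

Section ReidemeisterModel.
Variable k : nat.
Local Notation M := (model k).
Local Notation mk := (mk k).

Variables (phi : M -> M) (D eps t p q r s u v m n x : int).
Hypothesis phiM : {morph phi : g h / (g * h)%g}.
Hypothesis shape : auto_shape phi D eps t p q r s u v m n x.

Lemma shape_e2 a b c d : (phi (mk a b c d)).1.1.2 = eps * b.
Proof.
have [ao|ae] := boolP (is_odd (mk a b c d)); last first.
  have [i [b' [c' [d' e]]]] := even_mk ae; rewrite e.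
  by have [j ->] := shape_even shape b' c' d'; case: e => _ -> _ _.
have [i [b' [c' [d' e]]]] := odd_mk ao; rewrite e phiM.
have [j ->] := shape_even shape b' c' d'; rewrite (shape_alpha shape) mkM.
by move: e; rewrite mkM => /mk_inj[_ -> _ _]; rewrite /= !addr0.
Qed.

Lemma reidemeister_eps1 : eps = 1 -> reidemeister_number phi = +oo%E.
Proof.
move=> eps1; apply: (reidemeister_infinite phiM (f := fun n : nat => mk 0 n%:Z 0 0)).
move=> i j /twisted_conjE [[[[a b] c] d]] e.
have := congr1 (fun g : M => g.1.1.2) e.
have := shape_e2 a b c d; rewrite -[(a, b, c, d)]/(mk a b c d).
case: (phi _) => [[[a' b'] c'] d'] /= ->; rewrite eps1; lia.
Qed.

(** With sigma = (-1)^e0 chosen so that sigma - M is injective, an h in N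
    with g0 phi(h) e1^j = h g0 is a power of e1, which forces j = 0. An arbitrary
    h reduces to this case: its square lies in N and satisfies the same relation
    with 2 j. *)
Lemma reidemeister_det1 : eps = -1 -> D = 1 -> reidemeister_number phi = +oo%E.
Proof.
move=> epsN D1.
have detM : p * s - q * r = 1 by rewrite -(shape_det shape).
have [e0 e0N] : exists e, (sgn e - p) * (sgn e - s) - q * r != 0.
  have [T2|T2] := eqVneq (p + s) 2.
    by exists 1; rewrite (_ : sgn 1 = -1)//; move: detM T2; clear; lia.
  by exists 0; rewrite (_ : sgn 0 = 1)//; move: detM T2; clear; lia.
pose g0 := mk e0 0 0 0.
have phiz j : phi (mk (2 * j) 0 0 0) = mk (2 * j) 0 0 0.
  by rewrite (shape_center shape) D1; congr mk; ring.
have even_h h j : ~~ is_odd h ->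
    (g0 * phi h * mk (2 * j) 0 0 0)%g = (h * g0)%g -> j = 0.
  move=> /even_mk[i [b [c [d ->]]]]; have [l phil] := shape_even shape b c d.
  rewrite phil !mkM !parity_signM4 !sgn2 => /mk_inj[ea eb ec ed].
  have b0 : b = 0 by move: eb; rewrite epsN; clear; lia.
  have ec' : (sgn e0 - p) * c = q * d by move: ec; clear; lia.
  have ed' : (sgn e0 - s) * d = r * c by move: ed; clear; lia.
  have c0 : c = 0.
    apply: (mulfI e0N); rewrite mulr0.
    transitivity ((sgn e0 - s) * ((sgn e0 - p) * c) - q * (r * c)); first by ring.
    by rewrite ec' -ed'; ring.
  have d0 : d = 0.
    apply: (mulfI e0N); rewrite mulr0.
    transitivity ((sgn e0 - p) * ((sgn e0 - s) * d) - r * (q * d)); first by ring.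
    by rewrite ed' -ec'; ring.
  move: phil; rewrite b0 c0 d0 => /(_ i); rewrite phiz => /mk_inj[phil _ _ _].
  move: ea phil; rewrite b0 c0 d0 D1; clear; lia.
apply: (reidemeister_infinite phiM (f := fun n : nat => (g0 * mk (2 * n%:Z) 0 0 0)%g)).
move=> i j /twisted_conjE [h e].
have cz l g : commute (mk (2 * l) 0 0 0) g.
  by apply: (centralP (mk (2 * l) 0 0 0)).2; exists l, 0.
have {}e : (g0 * phi h * mk (2 * (i%:Z - j%:Z)) 0 0 0)%g = (h * g0)%g.
  apply: (mulIg (mk (2 * j%:Z) 0 0 0)).
  rewrite -[RHS]mulgA -e -!mulgA; congr (_ * _)%g; rewrite [RHS]cz; congr (_ * _)%g.
  by rewrite mkM; congr mk; ring.
have : 2 * (i%:Z - j%:Z) = 0; last by lia.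
apply: (even_h (h * h)%g); first by rewrite is_oddM addbb.
have -> : mk (2 * (2 * (i%:Z - j%:Z))) 0 0 0 =
    (mk (2 * (i%:Z - j%:Z)) 0 0 0 * mk (2 * (i%:Z - j%:Z)) 0 0 0)%g.
  by rewrite mkM; congr mk; ring.
set z := mk _ _ _ _ in e *.
have zh : (z * phi h = phi h * z)%g by exact: cz.
by rewrite phiM -[RHS]mulgA -e !mulgA -e -!mulgA (mulgA z) zh !mulgA.
Qed.

(** By Cayley-Hamilton M^2 = 1, so the rows of M + 1 are covectors fixed by
    M, and one of them, (l1, l2), is nonzero. Its value [lam] on the Z^2-part of
    an element of N is unchanged by twisting with N, and twisting by the other
    coset replaces it by [lam m n] minus it. The elements [f i] have values so large
    that this reflection cannot relate them. *)
Lemma reidemeister_trace0 : D = -1 -> p + s = 0 -> reidemeister_number phi = +oo%E.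
Proof.
move=> D1 T0.
have detM : p * s - q * r = -1 by rewrite -(shape_det shape).
(* If the first row of M + 1 starts with 0, then s = 1 and the second row is
   nonzero. *)
have [l1 [l2 [L0 [E1 E2]]]] : exists l1 l2, 0 < l1 * l1 + l2 * l2 /\
    l1 * p + l2 * r = l1 /\ l1 * q + l2 * s = l2.
  have sE : s = - p by move: T0; clear; lia.
  have qrE : q * r = 1 - p * p by move: detM; rewrite sE; clear; lia.
  have sq (y z : int) : y != 0 -> 0 < y * y + z * z by clear; nia.
  have [p1|p1] := eqVneq (p + 1) 0.
    exists r, (s + 1); split.
      by rewrite addrC; apply: sq; rewrite sE; move: p1; clear; lia.
    split; first by rewrite sE; ring.
    by rewrite [r * q]mulrC qrE sE; ring.
  exists (p + 1), q; split; first exact: sq.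
  by split; [rewrite qrE; ring|rewrite sE; ring].
pose lam y z := l1 * y + l2 * z.
have [K KE] : exists K, K = `|lam m n| by exists `|lam m n|.
pose N (i : nat) := i%:Z + 1 + K.
pose f (i : nat) := mk 0 0 (N i * l1) (N i * l2).
apply: (reidemeister_infinite phiM (f := f)) => i j /twisted_conjE [h].
have lamM y z : lam (p * y + q * z) (r * y + s * z) = lam y z.
  transitivity ((l1 * p + l2 * r) * y + (l1 * q + l2 * s) * z).
    by rewrite /lam; ring.
  by rewrite E1 E2.
have [ho|he] := boolP (is_odd h).
  have [a [b [c [d ->]]]] := odd_mk ho; have [l phil] := shape_even shape b c d.
  have xo : sgn x = -1.
    apply: sgn_odd; rewrite -(is_oddE k x 0 m n) -(shape_alpha shape).
    by rewrite (shape_odd shape).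
  rewrite phiM phil (shape_alpha shape) /f !mkM (_ : sgn 1 = -1)// xo.
  rewrite !sgnE (_ : sgn 0 = 1)// xo.
  move=> /mk_inj[_ _ ec ed].
  have lamE : lam m n = (N i + N j) * (l1 * l1 + l2 * l2).
    have /= := congr2 (fun y z => l1 * y + l2 * z) ec ed.
    by move: (lamM c d); rewrite /lam /N; clear; lia.
  have Ngt i' : `|lam m n| < N i' by rewrite -KE /N; move: KE; clear; lia.
  by move: (Ngt i) (Ngt j) L0 lamE; clear; nia.
have [a [b [c [d ->]]]] := even_mk he; have [l phil] := shape_even shape b c d.
rewrite phil /f !mkM !sgnE (_ : sgn 0 = 1)//.
move=> /mk_inj[_ _ ec ed].
have : N i * (l1 * l1 + l2 * l2) = N j * (l1 * l1 + l2 * l2).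
  have /= := congr2 (fun y z => l1 * y + l2 * z) ec ed.
  by move: (lamM c d); rewrite /lam /N; clear; lia.
have L1 : l1 * l1 + l2 * l2 != 0 by move: L0; clear; lia.
by move=> /(mulIf L1); rewrite /N; clear; lia.
Qed.

(** * Counting twisted classes when D = eps = -1 *)

Section FiniteCase.
Hypotheses (D1 : D = -1) (eps1 : eps = -1).

(** Comparing e2-exponents shows that h has none, so h^2 is an odd power of
    e1. Then phi inverts h^2, whereas the equation says that it fixes h^2. *)
Lemma twisted_free g h : is_odd h -> (g * phi h)%g <> (h * g)%g.
Proof.
case: h => [[[a b] c] d]; rewrite -[(a, b, c, d)]/(mk a b c d) => ho e.
have b0 : b = 0.
  have := congr1 (fun g : M => g.1.1.2) e; have := shape_e2 a b c d.
  case: (phi _) => [[[a' b'] c'] d'] /= ->.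
  by case: (g) => [[[? b2] ?] ?] /=; rewrite eps1; clear; lia.
rewrite b0 in ho e *.
have hh : (mk a 0 c d * mk a 0 c d)%g = mk (2 * (a - 2 * (k%:Z * d * c))) 0 0 0.
  by rewrite mkM sgn_odd//; congr mk; ring.
have : (g * phi (mk a 0 c d * mk a 0 c d))%g = (mk a 0 c d * mk a 0 c d * g)%g.
  by rewrite phiM mulgA e -!mulgA e.
rewrite hh (shape_center shape) D1 eps1.
case: (g) => [[[a2 b2] c2] d2]; rewrite -[(_, _, _, _)]/(mk a2 b2 c2 d2).
rewrite !mkM => /mk_inj[ea _ _ _].
by move: ho ea; rewrite is_oddE; clear; lia.
Qed.

(** When [rep] represents the cosets of the lattice of (-1)^e - M, these
    represent the N-twisted classes: those in N for e = 0, those in the other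
    coset of N for e = 1. *)
Definition coset_rep (e : int) (F : finType) (rep : F -> int * int)
    (i : 'I_2 * 'I_2 * F) : M :=
  mk (2 * (i.1.1 : nat)%:Z + e) (i.1.2 : nat)%:Z (rep i.2).1 (rep i.2).2.

(** All coordinates but the first, and the first modulo 4, transform
    linearly, since commutators in N are powers of e1^(2k) = alpha^(4k). Agreement
    modulo 4 suffices: multiplying h by e1^i shifts the first coordinates of
    the two sides in opposite directions, by 2 i each, as D = -1. *)
Lemma even_twist e a b c d a' b' c' d' :
  (exists h, ~~ is_odd h /\
     (mk (2 * a + e) b c d * phi h)%g = (h * mk (2 * a' + e) b' c' d')%g) <->
  exists z w1 w2, [/\ b = b' + 2 * z,
    c = c' + ((sgn e - p) * w1 + (- q) * w2),
    d = d' + ((- r) * w1 + (sgn e - s) * w2)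
  & (2 %| a - a' + t * z + u * w1 + v * w2)%Z].
Proof.
split=> [[h [/even_mk[i [z [w1 [w2 ->]]]]]]|[z [w1 [w2 [-> -> -> /dvdzP[j jE]]]]]].
  have [l ->] := shape_even shape z w1 w2.
  rewrite !mkM !sgnE D1 eps1 => /mk_inj[ea eb ec ed].
  exists z, w1, w2; split.
  - by move: eb; clear; lia.
  - by move: ec; clear; lia.
  - by move: ed; clear; lia.
  - by move: ea; clear; lia.
have [l phil] := shape_even shape z w1 w2.
set cc := c' + _; set dd := d' + _.
pose i := j + l + k%:Z * dd * (p * w1 + q * w2) - k%:Z * sgn e * w2 * c'.
exists (mk (2 * i) z w1 w2); split; first by rewrite is_oddE; clear; lia.
rewrite phil !mkM !sgnE D1 eps1; congr mk.
- have -> : a = j * 2 + a' - t * z - u * w1 - v * w2 by move: jE; clear; lia.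
  by rewrite /i; ring.
- by ring.
- by rewrite /cc; ring.
- by rewrite /dd; ring.
Qed.

Lemma coset_rep_surj (e : int) (F : finType) (rep : F -> int * int) :
    (forall w : int * int, exists i w1 w2,
      w.1 = (rep i).1 + ((sgn e - p) * w1 + (- q) * w2) /\
      w.2 = (rep i).2 + ((- r) * w1 + (sgn e - s) * w2)) ->
  forall a b c d, exists i h, ~~ is_odd h /\
    (mk (2 * a + e) b c d * phi h)%g = (h * coset_rep e rep i)%g.
Proof.
move=> repS a b c d; have [i [w1 [w2 /= [cE dE]]]] := repS (c, d).
have mod2 (y : int) : exists i : 'I_2, (2 %| y - (i : nat)%:Z)%Z.
  have lt2 : (`|(y %% 2)%Z| < 2)%N by clear; lia.
  by exists (Ordinal lt2) => /=; clear; lia.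
have [i2 /dvdzP[z zE]] := mod2 b.
have [i1 i1P] := mod2 (a + t * z + u * w1 + v * w2).
exists (i1, i2, i); apply/even_twist; exists z, w1, w2; split=> //=.
- by move: zE; clear; lia.
- by move: i1P; clear; lia.
Qed.

(** Once the Z^2-parts represent the same coset, injectivity of sigma - M
    makes h central, so the remaining coordinates agree modulo 2. *)
Lemma coset_rep_inj (e : int) (F : finType) (rep : F -> int * int) :
    (sgn e - p) * (sgn e - s) - - q * - r != 0 ->
    (forall i j w1 w2,
      (rep i).1 = (rep j).1 + ((sgn e - p) * w1 + (- q) * w2) ->
      (rep i).2 = (rep j).2 + ((- r) * w1 + (sgn e - s) * w2) -> i = j) ->
  forall i j h, ~~ is_odd h ->
    (coset_rep e rep i * phi h)%g = (h * coset_rep e rep j)%g -> i = j.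
Proof.
move=> det0 repI [[i1 i2] i] [[j1 j2] j] h he hE.
have /even_twist /= [z [w1 [w2 [eb ec ed ea]]]] : exists h, ~~ is_odd h /\
  (coset_rep e rep (i1, i2, i) * phi h)%g = (h * coset_rep e rep (j1, j2, j))%g.
  by exists h.
have ij : i = j by exact: repI ec ed.
rewrite ij in ec ed *.
have w1E : w1 = 0.
  apply: (mulfI det0); rewrite mulr0.
  transitivity ((sgn e - s) * ((sgn e - p) * w1 - q * w2)
                + q * (- r * w1 + (sgn e - s) * w2)); first by ring.
  have -> : (sgn e - p) * w1 - q * w2 = 0 by move: ec; clear; lia.
  have -> : - r * w1 + (sgn e - s) * w2 = 0 by move: ed; clear; lia.
  by rewrite !mulr0.
have w2E : w2 = 0.
  apply: (mulfI det0); rewrite mulr0.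
  transitivity (r * ((sgn e - p) * w1 - q * w2)
                + (sgn e - p) * (- r * w1 + (sgn e - s) * w2)); first by ring.
  have -> : (sgn e - p) * w1 - q * w2 = 0 by move: ec; clear; lia.
  have -> : - r * w1 + (sgn e - s) * w2 = 0 by move: ed; clear; lia.
  by rewrite !mulr0.
have z0 : z = 0 by move: (ltn_ord i2) (ltn_ord j2) eb; clear; lia.
congr (_, _, _); apply: val_inj => /=.
- by move: (ltn_ord i1) (ltn_ord j1) ea; rewrite z0 w1E w2E !mulr0; clear; lia.
- by move: eb; rewrite z0; clear; lia.
Qed.

(** As det ((-1)^e - M) = T or -T with T = p + s, each coset of N consists of
    4|T| N-twisted classes. Twisting by alpha identifies them in pairs. *)
Lemma reidemeister_finite : p + s != 0 ->
  reidemeister_number phi = (4 * `|(p + s)%R|)%N%:E.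
Proof.
move=> T0.
have detM : p * s - q * r = -1 by rewrite -(shape_det shape).
have det0 : (sgn 0 - p) * (sgn 0 - s) - - q * - r = - (p + s).
  by rewrite (_ : sgn 0 = 1)//; move: detM; clear; lia.
have det1 : (sgn 1 - p) * (sgn 1 - s) - - q * - r = p + s.
  by rewrite (_ : sgn 1 = -1)//; move: detM; clear; lia.
have det0_neq0 : (sgn 0 - p) * (sgn 0 - s) - - q * - r != 0 by rewrite det0 oppr_eq0.
have det1_neq0 : (sgn 1 - p) * (sgn 1 - s) - - q * - r != 0 by rewrite det1.
have [F0 [rep0 [F0E rep0S rep0I]]] := lattice_transversal det0_neq0.
have [F1 [rep1 [F1E rep1S rep1I]]] := lattice_transversal det1_neq0.
pose rep (i : ('I_2 * 'I_2 * F0) + ('I_2 * 'I_2 * F1)) :=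
  match i with inl i => coset_rep 0 rep0 i | inr i => coset_rep 1 rep1 i end.
have rep0_odd i : ~~ is_odd (coset_rep 0 rep0 i).
  by rewrite is_oddE; clear; lia.
have rep1_odd i : is_odd (coset_rep 1 rep1 i).
  by rewrite is_oddE; clear; lia.
have twist_odd g g' h : ~~ is_odd h -> (g * phi h = h * g')%g -> is_odd g = is_odd g'.
  move=> /negPf he /(congr1 (@is_odd k)).
  by rewrite !is_oddM (shape_odd shape) he addbF.
have [|||N NE ->] := @reidemeister_index2 _ _ phiM (@is_odd k) (mk 1 0 0 0)
    (@is_oddM k) isT _ rep.
- exact: twisted_free.
- move=> [[[a b] c] d].
  have [a2|a2] := boolP (2 %| a)%Z.
    have [a0 a0E] : exists a0, a = 2 * a0 + 0.
      by exists (a %/ 2)%Z; move: a2; clear; lia.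
    have [i [h [he hE]]] := coset_rep_surj rep0S a0 b c d.
    by exists (inl i), h; split=> //; rewrite a0E.
  have [a0 a0E] : exists a0, a = 2 * a0 + 1.
    by exists (a %/ 2)%Z; move: a2; clear; lia.
  have [i [h [he hE]]] := coset_rep_surj rep1S a0 b c d.
  by exists (inr i), h; split=> //; rewrite a0E.
- move=> [i|i] [j|j] h he hE.
  + by congr inl; exact: (coset_rep_inj det0_neq0 rep0I he hE).
  + by have := twist_odd _ _ _ he hE; rewrite rep1_odd (negPf (rep0_odd _)).
  + by have := twist_odd _ _ _ he hE; rewrite rep1_odd (negPf (rep0_odd _)).
  + by congr inr; exact: (coset_rep_inj det1_neq0 rep1I he hE).
congr (_%:E); move: NE; rewrite card_sum !card_prod !card_ord F0E F1E det0 det1.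
by clear; lia.
Qed.

End FiniteCase.
End ReidemeisterModel.

(** * Realization of the finite values *)

Section Realization.
Variables (k : nat) (N : int).
Local Notation M := (model k).
Local Notation mk := (mk k).

(** The matrix is (N 1 ; 1 0), and alpha, e2 go to their inverses. The
    quadratic terms come from collecting (e1^(kN) e3^N e4)^c e3^d, where the factor
    e1^(kN) makes phi(alpha) invert phi(e3). *)
Definition trace_auto (g : M) : M :=
  let: (a, b, c, d) := g in
  mk (- a + 2 * (k%:Z * N * (c * c)) + 4 * (k%:Z * c * d)) (- b) (N * c + d) c.

Definition trace_auto_inv (g : M) : M :=
  let: (a, b, c, d) := g in
  mk (- a + 2 * (k%:Z * N * (d * d)) + 4 * (k%:Z * d * (c - N * d))) (- b)
     d (c - N * d).

Lemma trace_autoM : {morph trace_auto : g h / (g * h)%g}.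
Proof.
move=> [[[a b] c] d] [[[a' b'] c'] d'].
rewrite -[(a, b, c, d)]/(mk a b c d) -[(a', b', c', d')]/(mk a' b' c' d').
rewrite /trace_auto mkM /= mkM.
rewrite !sgnE parity_signN !mulr1.
by case: (parity_signP a') => ->; congr mk; ring.
Qed.

Lemma trace_auto_bij : bijective trace_auto.
Proof.
by exists trace_auto_inv => -[[[a b] c] d]; congr (_, _, _, _); ring.
Qed.

Lemma trace_auto_shape :
  auto_shape trace_auto (-1) (-1) 0 N 1 1 0 (k%:Z * N) 0 0 0 (-1).
Proof.
split; rewrite ?mulr0 ?sub0r ?mulr1//; first by right.
- by right.
- move=> [[[a b] c] d]; rewrite /is_odd /=.
  by move: (k%:Z * N * (c * c)) (k%:Z * c * d) => y z; lia.
- by move=> i b; congr mk; ring.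
- by congr mk; ring.
- move=> b c d; have /dvdzP[j jE] : (2 %| c * (c - 1))%Z.
    have [i ci] : exists i, c = 2 * i \/ c = 2 * i + 1.
      by exists (c %/ 2)%Z; lia.
    by case: ci => ->; lia.
  exists (k%:Z * N * j + k%:Z * c * d) => i; congr mk; last by ring.
  + have -> : 4 * (k%:Z * N * j + k%:Z * c * d) =
      2 * (k%:Z * N) * (j * 2) + 4 * (k%:Z * c * d) by ring.
    by rewrite -jE; ring.
  + by ring.
  + by ring.
Qed.

End Realization.

Theorem mainTheorem3 (k : nat) (hk : (1 <= k)%N) :
  Spec_R (Gamma k) =
    [set (4 * n)%N%:E | n in [set n : nat | (1 <= n)%N]] `|` [set +oo%E].
Proof.
have [f fM f_bij] := Gamma_isog k.
rewrite (Spec_R_isog fM f_bij) Spec_RE; apply/seteqP; split.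
  move=> _ [phi [phiM phi_bij] <-].
  have [D [eps [t [p [q [r [s [u [v [m [n [x shape]]]]]]]]]]]] :=
    auto_shapeP hk phiM phi_bij.
  have [eps1|epsN] := shape_eps shape.
    by right; exact: reidemeister_eps1 phiM shape eps1.
  have [D1|DN] := shape_D shape.
    by right; exact: reidemeister_det1 phiM shape epsN D1.
  have [T0|T0] := eqVneq (p + s) 0.
    by right; exact: reidemeister_trace0 phiM shape DN T0.
  left; exists `|(p + s)%R|%N; first by rewrite /= absz_gt0.
  by rewrite (reidemeister_finite phiM shape).
move=> _ [[n /= n_gt0 <-]|->].
  exists (@trace_auto k n).
    by split; [exact: trace_autoM|exact: trace_auto_bij].
  rewrite (reidemeister_finite (@trace_autoM _ _) (trace_auto_shape k n)) ?addr0//.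
  by lia.
have shape : auto_shape (id : model k -> model k) 1 1 0 1 0 0 1 0 0 0 0 1.
  split=> //; [by left|by left|by move=> i b; congr mk; ring|].
  by move=> b c d; exists 0 => i; congr mk; ring.
exists id; first by split=> //; exists id.
by rewrite (reidemeister_eps1 _ shape).
Qed.
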